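(* Let $S$ be a finitely generated semigroup and let $T$ be a subsemigroup of $S$ with finite Green index. Then $S$ has soluble word problem if and only if $T$ and all the $T$-relative Schützenberger groups of $\mathscr{H}^T$-classes in $S\setminus T$ have soluble word problem.
   Context: For a semigroup $S$, $S^1=S\cup\{1\}$ denotes $S$ with a new identity element $1\notin S$ adjoined; for $X\subseteq S$, $X^1=X\cup\{1\}$. For a subsemigroup $T$ of $S$ and $u,v\in S$: $u\,\mathscr{R}^T v$ iff $uT^1=vT^1$; $u\,\mathscr{L}^T v$ iff $T^1u=T^1v$; $\mathscr{H}^T=\mathscr{R}^T\cap\mathscr{L}^T$. Each $\mathscr{H}^T$-class lies wholly in $T$ or wholly in $S\setminus T$. The Green index of $T$ in $S$ is one more than the number of $\mathscr{H}^T$-classes contained in $S\setminus T$. For an $\mathscr{H}^T$-class $H$, let $\mathrm{Stab}(H)=\{t\in T^1: Ht=H\}$ and let $\gamma(H)$ be the congruence on $\mathrm{Stab}(H)$ given by $(x,y)\in\gamma(H)$ iff $hx=hy$ for all $h\in H$. The quotient $\Gamma(H)=\mathrm{Stab}(H)/\gamma(H)$ is a group, the $T$-relative Schützenberger group of $H$. A semigroup $S$ generated by a finite set $A$ has soluble word problem if there is an algorithm which, for any two words $u,v\in A^+$, decides whether $u=v$ holds in $S$; this does not depend on the choice of finite generating set. (Under the hypotheses of the claim, $T$ and all the relative Schützenberger groups in question are finitely generated, so the notion applies to them.) *)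

(* Defs.v *)
From HB Require Import structures.
From mathcomp Require Import all_boot generic_quotient.
From mathcomp Require Import boolp classical_sets cardinality.

Set Implicit Arguments.
Unset Strict Implicit.
Unset Printing Implicit Defensive.

Local Open Scope classical_set_scope.
Local Open Scope quotient_scope.
Local Open Scope group_scope.

(* Kleene's general recursive functions: total functions only, minimisation
   being allowed just when a zero always exists.  The rules constrain a function
   by its defining equations, so the class is closed under pointwise equality. *)
Inductive recursive : forall n : nat, (n.-tuple nat -> nat) -> Prop :=
| rec_zero n f : (forall x, f x = 0) -> @recursive n f
| rec_succ f : (forall x, f x = (tnth x ord0).+1) -> @recursive 1 f
| rec_proj n (i : 'I_n) f : (forall x, f x = tnth x i) -> @recursive n f
| rec_comp m n (g : m.-tuple nat -> nat) (h : 'I_m -> n.-tuple nat -> nat) f :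
    recursive g -> (forall i, recursive (h i)) ->
    (forall x, f x = g [tuple h i x | i < m]) ->
    @recursive n f
| rec_prim n (g : n.-tuple nat -> nat) (h : n.+2.-tuple nat -> nat) f :
    recursive g -> recursive h ->
    (forall x : n.-tuple nat, f (cons_tuple 0 x) = g x) ->
    (forall k (x : n.-tuple nat), f (cons_tuple k.+1 x)
      = h (cons_tuple k (cons_tuple (f (cons_tuple k x)) x))) ->
    @recursive n.+1 f
| rec_min n (g : n.+1.-tuple nat -> nat) f :
    recursive g ->
    (forall x : n.-tuple nat, g (cons_tuple (f x) x) = 0) ->
    (forall (x : n.-tuple nat) k, k < f x -> g (cons_tuple k x) <> 0) ->
    @recursive n f.

(* [S^1]: the identity [None] is new even if [S] already has one. *)
Definition adjoin1 (S : Type) := option S.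

Section Adjoin1.
Variable S : semigroupType.

HB.instance Definition _ := Choice.on (adjoin1 S).

Definition mul1 (x y : adjoin1 S) : adjoin1 S :=
  match x, y with
  | None, _ => y
  | _, None => x
  | Some a, Some b => Some (a * b)
  end.

Lemma mul1A : associative mul1.
Proof. by case=> [a|] [b|] [c|] //=; rewrite mulgA. Qed.

Lemma mul1x : left_id None mul1.
Proof. by []. Qed.

Lemma mulx1 : right_id None mul1.
Proof. by case. Qed.

HB.instance Definition _ := isMonoid.Build (adjoin1 S) mul1A mul1x mulx1.

Definition to1 (x : S) : adjoin1 S := Some x.

End Adjoin1.

Section WordProblem.
Variable S : semigroupType.

Definition word_val n (a : 'I_n -> S) (w : seq 'I_n) : adjoin1 S :=
  \prod_(i <- w) to1 (a i).

Definition generates n (a : 'I_n -> S) :=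
  forall x : S, exists2 w, w <> [::] & word_val a w = to1 x.

Definition finitely_generated := exists n (a : 'I_n -> S), generates a.

Definition word_code n (w : seq 'I_n) : nat :=
  CodeSeq.code [seq nat_of_ord i | i <- w].

Definition word_problem_decidable n (a : 'I_n -> S) :=
  exists2 f : 2.-tuple nat -> nat, recursive f &
    forall u v : seq 'I_n, u <> [::] -> v <> [::] ->
      f [tuple word_code u; word_code v] = (word_val a u == word_val a v).

Definition soluble_word_problem :=
  exists n (a : 'I_n -> S), generates a /\ word_problem_decidable a.

End WordProblem.

Section Subsemigroup.
Variables (S : semigroupType) (T : mulgClosed S).

Record subsemigroup := Subsemigroup {
  subsemigroup_val :> S;
  subsemigroup_valP : subsemigroup_val \in T
}.

HB.instance Definition _ := [isSub for subsemigroup_val].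
HB.instance Definition _ := [Choice of subsemigroup by <:].
HB.instance Definition _ :=
  SubChoice_isSubSemigroup.Build S (mem T) subsemigroup (@gpredM S T).

End Subsemigroup.

Section RelativeGreen.
Variables (S : semigroupType) (T : mulgClosed S).

Definition sub1 : set (adjoin1 S) := None |` [set to1 t | t in [set` T]].

Definition greenR (u v : S) :=
  [set to1 u * t | t in sub1] = [set to1 v * t | t in sub1].

Definition greenL (u v : S) :=
  [set t * to1 u | t in sub1] = [set t * to1 v | t in sub1].

Definition greenH (u v : S) := greenR u v /\ greenL u v.

Definition greenH_class (H : set S) := exists u, H = [set v | greenH u v].

Definition outer_greenH_class (H : set S) :=
  greenH_class H /\ H `<=` ~` [set` T].

(* The Green index is one more than the cardinality of this set. *)
Definition finite_green_index := finite_set outer_greenH_class.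

End RelativeGreen.

(* Built for any [H], as a monoid; it is a group when [H] is an H^T-class. *)
Section Schutzenberger.
Variables (S : semigroupType) (T : mulgClosed S) (H : set S).

Definition stab : set (adjoin1 S) :=
  [set t | sub1 T t /\ [set to1 h * t | h in H] = [set to1 h | h in H]].

Record stabilizer := Stabilizer {
  stabilizer_val :> adjoin1 S;
  stabilizer_valP : stabilizer_val \in stab
}.

HB.instance Definition _ := [isSub for stabilizer_val].
HB.instance Definition _ := [Choice of stabilizer by <:].

Lemma sub1M s t : sub1 T s -> sub1 T t -> sub1 T (s * t).
Proof.
case=> [->|[x xT <-]]; first by rewrite mul1g.
case=> [->|[y yT <-]]; first by rewrite mulg1; right; exists x.
by right; exists (x * y) => //=; apply: gpredM.
Qed.

Lemma stab_monoid_closed : monoid_closed (mem stab).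
Proof.
split.
  apply/mem_set; split; first by left.
  by apply: eq_imagel => h _; rewrite mulg1.
move=> s t /set_mem[sT sH] /set_mem[tT tH]; apply/mem_set; split.
  exact: sub1M.
apply/seteqP; split=> x.
  case=> h hH <-; have [h1 h1H h1E] : [set to1 k | k in H] (to1 h * s).
    by rewrite -sH; exists h.
  by rewrite mulgA -h1E -tH; exists h1.
rewrite -[X in X x -> _]tH => -[h1 h1H <-].
have [h hH hE] : [set to1 k * s | k in H] (to1 h1) by rewrite sH; exists h1.
by exists h => //; rewrite mulgA hE.
Qed.

HB.instance Definition _ :=
  SubChoice_isSubMonoid.Build (adjoin1 S) (mem stab) stabilizer
    stab_monoid_closed.

Definition schutz_rel (x y : stabilizer) : bool :=
  `[< forall h, H h -> to1 h * val x = to1 h * val y >].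

Lemma schutz_rel_equiv : equiv_class_of schutz_rel.
Proof.
split=> [x|x y|y x z].
- exact/asboolP.
- by apply/asboolP/asboolP=> E h /E.
- by move=> /asboolP xy /asboolP yz; apply/asboolP=> h hH; rewrite xy ?yz.
Qed.

Canonical schutz_equiv := EquivRelPack schutz_rel_equiv.

Definition schutzenberger := {eq_quot schutz_equiv}.

HB.instance Definition _ := Choice.on schutzenberger.
HB.instance Definition _ := EqQuotient.on schutzenberger.

Lemma schutz_relM (x x' y y' : stabilizer) :
  schutz_rel x x' -> schutz_rel y y' -> schutz_rel (x * y) (x' * y').
Proof.
move=> /asboolP xx' /asboolP yy'; apply/asboolP=> h hH.
rewrite !valM !mulgA -xx' //.
have [_ xH] := set_mem (stabilizer_valP x).
have [k kH <-] : [set to1 k | k in H] (to1 h * val x) by rewrite -xH; exists h.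
exact: yy'.
Qed.

Definition schutz_one : schutzenberger := \pi_schutzenberger 1.
Definition schutz_mul (p q : schutzenberger) : schutzenberger :=
  \pi_schutzenberger (repr p * repr q).

Lemma schutz_mul_pi (x y : stabilizer) :
  schutz_mul (\pi_schutzenberger x) (\pi_schutzenberger y)
  = \pi_schutzenberger (x * y).
Proof.
by apply/eqmodP; apply: schutz_relM; apply/(@eqmodP _ schutz_equiv);
  rewrite reprK.
Qed.

Lemma schutz_mulA : associative schutz_mul.
Proof.
move=> p q r; rewrite -[p]reprK -[q]reprK -[r]reprK.
move: (repr p) (repr q) (repr r) => x y z.
by rewrite (schutz_mul_pi y z) (schutz_mul_pi x y) !schutz_mul_pi mulgA.
Qed.

Lemma schutz_mul1x : left_id schutz_one schutz_mul.
Proof. by move=> p; rewrite -[p]reprK schutz_mul_pi mul1g. Qed.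

Lemma schutz_mulx1 : right_id schutz_one schutz_mul.
Proof. by move=> p; rewrite -[p]reprK schutz_mul_pi mulg1. Qed.

HB.instance Definition _ :=
  isMonoid.Build schutzenberger schutz_mulA schutz_mul1x schutz_mulx1.

End Schutzenberger.

(* Main.v *)
Require Import Defs.
From mathcomp Require Import all_boot generic_quotient.
From mathcomp Require Import boolp classical_sets cardinality.

(** Fix representatives [h q] of the finitely many H-classes outside T, and let 1
represent T with the identity adjoined. Every element is then a left multiple
[t * h q], and also a right multiple [h q * t], of its representative by an
element [t] of this submonoid, and all computations can be made with words over
T and finitely many states [q].

Reading a word over the generators of S from left to right and replacing
[h q * a] by [t * h q'] turns its value into [t * h q], where [t] is a product
of elements of T ([left_pass]). Reading this product from right to left and
replacing [t * h q] by [h q' * s] gives the form [h q * s] ([right_pass]).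
Because R is a left congruence, the final [q] tells whether the value lies in T
and, if not, what its R-class is. When the value lies in T, the form is a product
over a finite set, whence T is finitely generated ([submonoid_generators]) and two
such values are compared in T. Otherwise [s] describes a path inside an R-class
of S \ T, a union of finitely many H-classes. Fixed translations between these
classes cut the path into Schreier loops at one chosen class H ([schreier_pass]),
so the group of H is finitely generated ([schutzenberger_generators]), and two
values in the R-class are equal exactly when they lie in the same H-class and
their loops agree in the group ([decides_R_class]). This decides equality in S
from equality in T and in the groups ([decides_green]).

Conversely the generators of T, and lifts of the generators of the groups, are
words over the generators of S. Two elements of the group of H agree as soon as
they act alike on one point of H, so both word problems reduce to that of S
([decides_pullback]).

The three passes are transductions by finite automata. Computability thus
enters only through the run of an automaton on the code of a word
([recursive_transduce]); [decides_transduce] then says that decidability of a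
relation may be tested after transductions, with a case distinction on their
final states. *)

Set Implicit Arguments.
Unset Strict Implicit.
Unset Printing Implicit Defensive.

Local Open Scope nat_scope.

(** * Closure properties of recursive functions *)

Definition recursive1 (g : nat -> nat) :=
  recursive (fun x : 1.-tuple nat => g (tnth x ord0)).

Definition recursive2 (g : nat -> nat -> nat) :=
  recursive (fun x : 2.-tuple nat => g (tnth x ord0) (tnth x ord_max)).

Lemma recursive_ext n (f g : n.-tuple nat -> nat) :
  f =1 g -> recursive f -> recursive g.
Proof.
move=> fg rf; apply: (rec_comp (h := fun i x => tnth x i) rf).
  by move=> i; apply: (rec_proj (i := i)).
by move=> x; rewrite -fg; congr f; apply: eq_from_tnth => i; rewrite tnth_mktuple.
Qed.

Lemma recursive_tnth n (i : 'I_n) : recursive (fun x : n.-tuple nat => tnth x i).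
Proof. exact: (rec_proj (i := i)). Qed.

Lemma recursive_comp1 n g (f : n.-tuple nat -> nat) :
  recursive1 g -> recursive f -> recursive (fun x => g (f x)).
Proof.
move=> rg rf; apply: (rec_comp (h := fun=> f) rg) => // x.
by rewrite tnth_mktuple.
Qed.

Lemma recursive_comp2 n g (f1 f2 : n.-tuple nat -> nat) :
  recursive2 g -> recursive f1 -> recursive f2 ->
  recursive (fun x => g (f1 x) (f2 x)).
Proof.
move=> rg rf1 rf2.
apply: (rec_comp (h := fun i : 'I_2 => if i == ord0 then f1 else f2) rg).
  by move=> i; case: ifP.
by move=> x; rewrite !tnth_mktuple.
Qed.

Lemma recursive2_app (f : 2.-tuple nat -> nat) :
  recursive f -> recursive2 (fun x y => f [tuple x; y]).
Proof.
apply: recursive_ext => x; congr f; apply: eq_from_tnth => i.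
rewrite (tnth_nth 0); case/tupleP: x => x t; case/tupleP: t => y t.
by rewrite (tuple0 t) (tnth_nth 0); case: i => [[|[|[]]]].
Qed.

Lemma recursive_const n c : recursive (fun _ : n.-tuple nat => c).
Proof.
elim: c => [|c IHc]; first exact: rec_zero.
by apply: (recursive_comp1 (g := succn) _ IHc); apply: rec_succ.
Qed.

Lemma recursive_succ n (f : n.-tuple nat -> nat) :
  recursive f -> recursive (fun x => (f x).+1).
Proof. by apply: (recursive_comp1 (g := succn)); apply: rec_succ. Qed.

Lemma recursive_behead n (g : n.-tuple nat -> nat) :
  recursive g -> recursive (fun x : n.+1.-tuple nat => g [tuple of behead x]).
Proof.
move=> rg; apply: (rec_comp
  (h := fun (i : 'I_n) (x : n.+1.-tuple nat) => tnth x (lift ord0 i)) rg).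
  by move=> i; apply: recursive_tnth.
move=> x; congr g; apply: eq_from_tnth => i.
rewrite tnth_behead tnth_mktuple; congr tnth; apply: val_inj.
by rewrite /= inordK // ltnS.
Qed.

Lemma recursive_nat_rec n (g k : n.-tuple nat -> nat)
    (s : nat -> nat -> n.-tuple nat -> nat) :
  recursive g -> recursive k ->
  recursive (fun x : n.+2.-tuple nat =>
    s (tnth x ord0) (tnth x (lift ord0 ord0)) [tuple of behead (behead x)]) ->
  recursive (fun x => nat_rect (fun=> nat) (g x) (fun i r => s i r x) (k x)).
Proof.
move=> rg rk rs.
pose F (x : n.+1.-tuple nat) :=
  nat_rect (fun=> nat) (g [tuple of behead x])
    (fun i r => s i r [tuple of behead x]) (thead x).
have beheadK m (a : nat) (x : m.-tuple nat) :
  [tuple of behead (cons_tuple a x)] = x by exact: val_inj.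
have rF : recursive F.
  apply: (rec_prim rg rs) => [x|i x]; rewrite /F !beheadK //=.
  by rewrite !(tnth_nth 0) /=; congr s; apply: val_inj.
apply: (rec_comp
  (h := fun (i : 'I_n.+1) => if unlift ord0 i is Some j
                             then fun x => tnth x j else k) rF).
  by move=> i; case: unliftP => [j|] _ //; apply: recursive_tnth.
move=> x; rewrite /F /thead tnth_mktuple unlift_none.
rewrite (_ : [tuple of behead _] = x) //.
apply: eq_from_tnth => i; rewrite tnth_behead tnth_mktuple.
rewrite (_ : inord _ = lift ord0 i) ?liftK //.
by apply: val_inj; rewrite /= inordK // ltnS.
Qed.

Lemma recursive_iter n s (k g : n.-tuple nat -> nat) :
  recursive1 s -> recursive k -> recursive g ->
  recursive (fun x => iter (k x) s (g x)).
Proof.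
move=> rs rk rg.
have := recursive_nat_rec (s := fun _ r _ => s r) rg rk
  (recursive_comp1 rs (recursive_tnth _)).
by apply: recursive_ext => x; elim: (k x) => //= m ->.
Qed.

Lemma recursive_if n (c f g : n.-tuple nat -> nat) :
  recursive c -> recursive f -> recursive g ->
  recursive (fun x => if c x == 0 then f x else g x).
Proof.
move=> rc rf rg.
have := recursive_nat_rec (s := fun _ _ => g) rf rc
  (recursive_behead (recursive_behead rg)).
by apply: recursive_ext => x; case: (c x).
Qed.

Lemma recursive_pred n (f : n.-tuple nat -> nat) :
  recursive f -> recursive (fun x => (f x).-1).
Proof.
move=> rf; have := recursive_nat_rec (s := fun i _ _ => i)
  (recursive_const n 0) rf (recursive_tnth ord0).
by apply: recursive_ext => x; case: (f x).
Qed.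

Lemma recursive_double n (f : n.-tuple nat -> nat) :
  recursive f -> recursive (fun x => (f x).*2).
Proof.
move=> rf; have rS : recursive1 succn by apply: rec_succ.
have := recursive_iter rS rf rf; apply: recursive_ext => x.
by rewrite iter_succn addnn.
Qed.

Lemma recursive_odd n (f : n.-tuple nat -> nat) :
  recursive f -> recursive (fun x => odd (f x)).
Proof.
move=> rf; have := recursive_iter (s := fun r => if r == 0 then 1 else 0)
  (recursive_if (recursive_tnth _) (recursive_const _ 1) (recursive_const _ 0))
  rf (recursive_const n 0).
by apply: recursive_ext => x; elim: (f x) => //= m ->; case: odd.
Qed.

Lemma recursive_half n (f : n.-tuple nat -> nat) :
  recursive f -> recursive (fun x => (f x)./2).
Proof.
move=> rf.
have rodd i : recursive (fun x : n.+2.-tuple nat => odd (tnth x i)).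
  exact: recursive_odd (recursive_tnth i).
have := recursive_nat_rec
  (s := fun i r _ => if nat_of_bool (odd i) == 0 then r else r.+1)
  (recursive_const n 0) rf
  (recursive_if (rodd _) (recursive_tnth _) (recursive_succ (recursive_tnth _))).
apply: recursive_ext => x; elim: (f x) => //= m ->.
by rewrite uphalf_half; case: odd.
Qed.

(** This is what makes every finite table recursive. *)
Lemma recursive_switch n (c : n.-tuple nat -> nat) N
    (F : nat -> n.-tuple nat -> nat) :
  recursive c -> (forall i, i < N -> recursive (F i)) ->
  recursive (fun x => if c x < N then F (c x) x else 0).
Proof.
elim: N c F => [|N IHN] c F rc rF; first exact: recursive_const.
have := recursive_if rc (rF 0 isT)
  (IHN _ (fun i => F i.+1) (recursive_pred rc) (fun i => rF i.+1)).
by apply: recursive_ext => x; case: (c x).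
Qed.

(** * Codes of words *)

Definition code_cons x c := 2 ^ x * c.*2.+1.

Definition code_head c := logn 2 c.

Definition code_tail c := (c %/ 2 ^ code_head c)./2.

Lemma code_cons_gt0 x c : 0 < code_cons x c.
Proof. by rewrite muln_gt0 expn_gt0. Qed.

Lemma code_headK x c : code_head (code_cons x c) = x.
Proof.
rewrite /code_head lognM ?expn_gt0 // pfactorK // lognE /= dvdn2 /= odd_double.
by rewrite addn0.
Qed.

Lemma code_tailK x c : code_tail (code_cons x c) = c.
Proof.
by rewrite /code_tail code_headK mulKn ?expn_gt0 //= uphalf_double.
Qed.

Lemma size_code s : size s <= CodeSeq.code s.
Proof.
elim: s => //= x s IHs; rewrite (leq_trans (_ : _ <= (CodeSeq.code s).*2.+1)) //.
  by rewrite ltnS (leq_trans IHs) // -addnn leq_addr.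
by rewrite leq_pmull // expn_gt0.
Qed.

Lemma iter_half k c : iter k half c = c %/ 2 ^ k.
Proof.
by elim: k => [|k /= ->]; rewrite ?divn1 // -divn2 -divnMA -expnSr.
Qed.

Lemma code_head_half c k :
  0 < c -> k < code_head c -> ~~ odd (iter k half c).
Proof.
move=> c0; rewrite /code_head -pfactor_dvdn // iter_half expnS => /dvdnP[d ->].
by rewrite mulnA mulnK ?expn_gt0 // oddM andbF.
Qed.

Lemma code_head_odd c : 0 < c -> odd (iter (code_head c) half c).
Proof.
move=> c0; rewrite iter_half /code_head; apply: contraFT (ltnn (logn 2 c)).
rewrite -dvdn2 => /dvdnP[d dE].
rewrite -pfactor_dvdn // -[X in _ %| X](divnK (pfactor_dvdnn 2 c)) dE -mulnA.
by rewrite -expnS dvdn_mull.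
Qed.

Lemma recursive_code_cons n (f g : n.-tuple nat -> nat) :
  recursive f -> recursive g -> recursive (fun x => code_cons (f x) (g x)).
Proof.
move=> rf rg; have rdouble := recursive_double (@recursive_tnth 1 ord0).
have := recursive_iter rdouble rf (recursive_succ (recursive_double rg)).
apply: recursive_ext => x; rewrite /code_cons; elim: (f x) => [|m /= ->].
  by rewrite mul1n.
by rewrite expnS -mulnA mul2n.
Qed.

Lemma recursive_iter_half n (f g : n.-tuple nat -> nat) :
  recursive f -> recursive g -> recursive (fun x => iter (f x) half (g x)).
Proof. exact: recursive_iter (recursive_half (recursive_tnth _)). Qed.

Lemma recursive_code_head n (f : n.-tuple nat -> nat) :
  recursive f -> recursive (fun x => code_head (f x)).
Proof.
move=> rf; apply: (recursive_comp1 (g := code_head)) rf.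
pose g (x : 2.-tuple nat) :=
  if tnth x ord_max == 0 then 0
  else if nat_of_bool (odd (iter (tnth x ord0) half (tnth x ord_max))) == 0
       then 1 else 0.
have rg : recursive g.
  apply: recursive_if; try exact: recursive_tnth; try exact: recursive_const.
  apply: recursive_if; try exact: recursive_const.
 exact: recursive_odd (recursive_iter_half (recursive_tnth _) (recursive_tnth _)).
apply: (rec_min rg) => [x|x k]; rewrite /g !(tnth_nth 0) /=; case: x => -[|c []] //= _.
  by case: eqP => // /eqP; rewrite -lt0n => /code_head_odd ->.
case: eqP => [-> //|/eqP]; rewrite -lt0n => c0 /(code_head_half c0).
by rewrite /code_head /= => /negPf ->.
Qed.

Lemma recursive_code_tail n (f : n.-tuple nat -> nat) :
  recursive f -> recursive (fun x => code_tail (f x)).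
Proof.
move=> rf; have := recursive_half (recursive_iter_half (recursive_code_head rf) rf).
by apply: recursive_ext => x; rewrite /code_tail iter_half.
Qed.

Section Fold.

Variable F : nat -> nat -> nat.

(* The loop needs the word still to be read and the accumulator; the pair is
   coded as a word whose first letter is the code of the former. *)
Let step p :=
  if code_head p == 0 then p
  else code_cons (code_tail (code_head p)) (F (code_head (code_head p)) (code_tail p)).

Lemma iter_fold_step k w acc :
  size w <= k ->
  iter k step (code_cons (CodeSeq.code w) acc) =
  code_cons 0 (foldl (fun y x => F x y) acc w).
Proof.
elim: k w acc => [|k IHk] [|x w] acc // le_wk;
  rewrite iterSr [X in iter _ _ X]/step code_headK.
  by rewrite (IHk [::]).
by rewrite eqn0Ngt code_cons_gt0 /= code_headK !code_tailK IHk.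
Qed.

(** The loop runs as many times as the code of the word says: this is more than
enough by [size_code], and the loop is idle once the word has been read. *)
Lemma recursive_foldl n (f g : n.-tuple nat -> nat) (D : n.-tuple nat -> seq nat) :
  recursive2 F -> recursive f -> recursive g ->
  (forall x, f x = CodeSeq.code (D x)) ->
  recursive (fun x => foldl (fun y x => F x y) (g x) (D x)).
Proof.
move=> rF rf rg fD.
have rstep : recursive1 step.
  have rH := recursive_code_head (recursive_tnth (ord0 : 'I_1)).
  have rT := recursive_code_tail (recursive_tnth (ord0 : 'I_1)).
  apply: recursive_if => //; first exact: recursive_tnth.
  apply: (recursive_code_cons (recursive_code_tail rH)).
  exact: recursive_comp2 rF (recursive_code_head rH) rT.
have := recursive_code_tail (recursive_iter rstep rf (recursive_code_cons rf rg)).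
apply: recursive_ext => x; rewrite fD iter_fold_step ?size_code //.
exact: code_tailK.
Qed.

End Fold.

(** * Finite-state transductions on codes *)

(** The output is a stack: what is emitted on reading a letter goes in front of
what was emitted before. A pass that reads a word from its last letter thus
leaves its output in the right order, and a pass that reads from the first
letter leaves it reversed. *)
Definition transduce (Q A B : Type) (next : Q -> A -> Q) (emit : Q -> A -> seq B)
    (q : Q) (o : seq B) (w : seq A) : Q * seq B :=
  foldl (fun s a => (next s.1 a, emit s.1 a ++ s.2)) (q, o) w.

Lemma transduce_rcons (Q A B : Type) (next : Q -> A -> Q)
    (emit : Q -> A -> seq B) q o w a :
  let s := transduce next emit q o w in
  transduce next emit q o (rcons w a) = (next s.1 a, emit s.1 a ++ s.2).
Proof. by rewrite /transduce foldl_rcons. Qed.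

Definition state_code (Q : finType) m (s : Q * seq 'I_m) :=
  code_cons (index s.1 (enum Q)) (word_code s.2).

Lemma foldr_code_cons s t :
  foldr code_cons (CodeSeq.code t) s = CodeSeq.code (s ++ t).
Proof. by elim: s => //= x s ->. Qed.

(** State and output form one code, the state being its first letter, so a step is
a finite table of prefixes to be pushed on the rest of that code. *)
Lemma recursive_transduce n m (Q : finType) (next : Q -> 'I_n -> Q)
    (emit : Q -> 'I_n -> seq 'I_m) q0 o0 k (f : k.-tuple nat -> nat)
    (D : k.-tuple nat -> seq nat) :
  recursive f -> (forall x, f x = CodeSeq.code (D x)) ->
  exists2 g, recursive g & forall x w, D x = map val w ->
    g x = state_code (transduce next emit q0 o0 w).
Proof.
move=> rf fD.
pose F x p :=
  if code_head p < #|Q| then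
    let q := nth q0 (enum Q) (code_head p) in
    if x < n then
      if insub x is Some a then
        code_cons (index (next q a) (enum Q))
          (foldr code_cons (code_tail p) (map val (emit q a)))
      else 0
    else 0
  else 0.
have rF : recursive2 F.
  pose G i j p :=
    let q := nth q0 (enum Q) i in
    if insub j is Some a then
      code_cons (index (next q a) (enum Q))
        (foldr code_cons (code_tail p) (map val (emit q a)))
    else 0.
  have r2 (i : 'I_2) := recursive_tnth i.
  apply: (recursive_switch (F := fun i x =>
    if tnth x ord0 < n then G i (tnth x ord0) (tnth x ord_max) else 0)).
    exact: recursive_code_head.
  move=> i _; apply: (recursive_switch (F := fun j x => G i j (tnth x ord_max))).
    exact: r2.
  move=> j jn; rewrite /G; case: insub => [a|]; last exact: recursive_const.
  apply: recursive_code_cons; first exact: recursive_const.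
  elim: (map _ _) => [|y s IHs] /=; first exact: recursive_code_tail.
  by apply: recursive_code_cons => //; apply: recursive_const.
exists (fun x => foldl (fun p x => F x p) (state_code (q0, o0)) (D x)).
  by apply: (recursive_foldl (f := f)) => //; apply: recursive_const.
move=> x w ->; rewrite /transduce; elim/last_ind: w => // w a IHw.
rewrite map_rcons !foldl_rcons {}IHw.
case: (foldl _ _ w) => q o; rewrite /F /state_code /= code_headK code_tailK.
by rewrite cardE index_mem mem_enum nth_index ?mem_enum // ltn_ord valK
  foldr_code_cons /word_code map_cat.
Qed.

(** The relation [E] is only constrained on words of [D] and [D']: the normal forms
compared below come with invariants without which the comparison is wrong. *)
Definition decides n m (D : seq 'I_n -> Prop) (D' : seq 'I_m -> Prop)
    (E : seq 'I_n -> seq 'I_m -> bool) :=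
  exists2 f : 2.-tuple nat -> nat, recursive f &
    forall u v, D u -> D' v -> f [tuple word_code u; word_code v] = E u v.

Definition decides_all n m (E : seq 'I_n -> seq 'I_m -> bool) :=
  decides (fun=> True) (fun=> True) E.

Lemma decides_const n m (D : seq 'I_n -> Prop) (D' : seq 'I_m -> Prop)
    (E : seq 'I_n -> seq 'I_m -> bool) (b : bool) :
  (forall u v, D u -> D' v -> E u v = b) -> decides D D' E.
Proof.
move=> Eb; exists (fun=> b); first exact: recursive_const.
by move=> u v Du /(Eb _ _ Du) ->.
Qed.

(** Two words may be rewritten by finite-state transductions before they are
compared, and the comparison may depend on the two final states, since these
are finitely many. *)
Lemma decides_transduce n n' m m' (Q Q' : finType)
    (next : Q -> 'I_n -> Q) (emit : Q -> 'I_n -> seq 'I_m) q0 o0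
    (next' : Q' -> 'I_n' -> Q') (emit' : Q' -> 'I_n' -> seq 'I_m') q0' o0'
    (X : Q -> seq 'I_m -> Prop) (X' : Q' -> seq 'I_m' -> Prop)
    (Y : Q -> Q' -> seq 'I_m -> seq 'I_m' -> bool)
    (D : seq 'I_n -> Prop) (D' : seq 'I_n' -> Prop)
    (E : seq 'I_n -> seq 'I_n' -> bool) :
  let run := transduce next emit q0 o0 in
  let run' := transduce next' emit' q0' o0' in
  (forall q q', decides (X q) (X' q') (Y q q')) ->
  (forall u, D u -> X (run u).1 (run u).2) ->
  (forall v, D' v -> X' (run' v).1 (run' v).2) ->
  (forall u v, D u -> D' v ->
     E u v = Y (run u).1 (run' v).1 (run u).2 (run' v).2) ->
  decides D D' E.
Proof.
move=> run run' decY runX runX' EY.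
have /choice[f fP] : forall q : Q * Q', exists h : 2.-tuple nat -> nat,
    recursive h /\ forall u v, X q.1 u -> X' q.2 v ->
      h [tuple word_code u; word_code v] = Y q.1 q.2 u v.
  by case=> q q'; have [h rh hP] := decY q q'; exists h.
have tape (i : 'I_2) : exists2 g : 2.-tuple nat -> nat, recursive g &
    forall x, g x = CodeSeq.code (CodeSeq.decode (tnth x i)).
  exists (fun x => tnth x i); first exact: recursive_tnth.
  by move=> x; rewrite CodeSeq.decodeK.
have [t rt tE] := tape ord0; have [t' rt' tE'] := tape ord_max.
have [g rg gE] := recursive_transduce next emit q0 o0 rt tE.
have [g' rg' gE'] := recursive_transduce next' emit' q0' o0' rt' tE'.
pose h i j (x : 2.-tuple nat) :=
  f (nth q0 (enum Q) i, nth q0' (enum Q') j)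
    [tuple code_tail (g x); code_tail (g' x)].
exists (fun x =>
  if code_head (g x) < #|Q| then
    if code_head (g' x) < #|Q'| then h (code_head (g x)) (code_head (g' x)) x
    else 0
  else 0).
  apply: (recursive_switch (F := fun i x =>
    if code_head (g' x) < #|Q'| then h i (code_head (g' x)) x else 0)).
    exact: recursive_code_head.
  move=> i _; apply: (recursive_switch (F := fun j x => h i j x)).
    exact: recursive_code_head.
  move=> j _; rewrite /h.
  by apply: (recursive_comp2 (recursive2_app (fP _).1)); apply: recursive_code_tail.
move=> u v Du Dv.
rewrite (gE _ u) ?(gE' _ v); try by rewrite !(tnth_nth 0) /= CodeSeq.codeK.
rewrite /h (gE _ u) ?(gE' _ v); try by rewrite !(tnth_nth 0) /= CodeSeq.codeK.
rewrite /state_code !code_headK !code_tailK !cardE !index_mem !mem_enum.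
rewrite !nth_index ?mem_enum // (fP _).2 ?EY //=; [exact: runX | exact: runX'].
Qed.

(** * Deciding relations after a change of words *)

Section Substitution.

Let push (A B : Type) (phi : A -> seq B) o w :=
  (transduce (fun _ : unit => fun=> tt) (fun=> phi) tt o w).2.

Let pushE (A B : Type) (phi : A -> seq B) p w :
  push (rev \o phi) (rev p) w = rev (p ++ flatten (map phi w)).
Proof.
elim/last_ind: w => [|w a IHw]; first by rewrite cats0.
rewrite [LHS](_ : _ = rev (phi a) ++ push (rev \o phi) (rev p) w).
  by rewrite IHw -rev_cat map_rcons flatten_rcons catA.
by rewrite /push transduce_rcons.
Qed.

Let decides_push n m n' m' (phi : 'I_n' -> seq 'I_n) (psi : 'I_m' -> seq 'I_m) o o'
    (D : seq 'I_n -> Prop) (D' : seq 'I_m -> Prop) E :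
  decides D D' E ->
  decides (fun u => D (push phi o u)) (fun v => D' (push psi o' v))
    (fun u v => E (push phi o u) (push psi o' v)).
Proof.
move=> decE; apply: (@decides_transduce _ _ _ _ unit unit
  (fun _ _ => tt) (fun=> phi) tt o (fun _ _ => tt) (fun=> psi) tt o'
  (fun=> D) (fun=> D') (fun _ _ => E)) => //.
Qed.

Lemma decides_ext n m (D1 D2 : seq 'I_n -> Prop) (D1' D2' : seq 'I_m -> Prop) E1 E2 :
  decides D1 D1' E1 ->
  (forall u, D2 u -> D1 u) -> (forall v, D2' v -> D1' v) ->
  (forall u v, D2 u -> D2' v -> E1 u v = E2 u v) ->
  decides D2 D2' E2.
Proof.
move=> [f rf fE] D21 D21' E12; exists f => // u v Du Dv.
by rewrite fE ?E12 //; [apply: D21 | apply: D21'].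
Qed.

Lemma decides_rev n m (D : seq 'I_n -> Prop) (D' : seq 'I_m -> Prop) E :
  decides D D' E ->
  decides (fun u => D (rev u)) (fun v => D' (rev v)) (fun u v => E (rev u) (rev v)).
Proof.
have revE k (w : seq 'I_k) : push (rev \o (fun a => [:: a])) (rev [::]) w = rev w.
  by rewrite pushE flatten_seq1.
move=> /(decides_push (rev \o (fun a => [:: a])) (rev \o (fun a => [:: a]))
  (rev [::]) (rev [::])).
by move=> decE; apply: (decides_ext decE) => [u|v|u v]; rewrite !revE.
Qed.

Lemma decides_subst n m n' m' (phi : 'I_n' -> seq 'I_n) (psi : 'I_m' -> seq 'I_m) p q
    (D : seq 'I_n -> Prop) (D' : seq 'I_m -> Prop) E :
  decides D D' E ->
  decides (fun u => D (p ++ flatten (map phi u))) (fun v => D' (q ++ flatten (map psi v)))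
    (fun u v => E (p ++ flatten (map phi u)) (q ++ flatten (map psi v))).
Proof.
move=> /decides_rev /(decides_push (rev \o phi) (rev \o psi) (rev p) (rev q)) decE.
by apply: (decides_ext decE) => [u|v|u v]; rewrite !pushE !revK.
Qed.

End Substitution.

Local Open Scope group_scope.

(** * Words in a monoid *)

Section Eval.

Variable M : monoidType.

Definition eval (I : Type) (f : I -> M) (w : seq I) := \prod_(i <- w) f i.

Lemma eval_cat I (f : I -> M) u v : eval f (u ++ v) = eval f u * eval f v.
Proof. exact: big_cat. Qed.

Lemma eval_cons I (f : I -> M) i w : eval f (i :: w) = f i * eval f w.
Proof. exact: big_cons. Qed.

Lemma eval_rcons I (f : I -> M) w i : eval f (rcons w i) = eval f w * f i.
Proof. by rewrite -cats1 eval_cat /eval big_seq1. Qed.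

Lemma eval_nil I (f : I -> M) : eval f [::] = 1.
Proof. exact: big_nil. Qed.

Lemma eval_seq1 I (f : I -> M) i : eval f [:: i] = f i.
Proof. exact: big_seq1. Qed.

Lemma eval_flatten I J (f : I -> M) (phi : J -> seq I) w :
  eval f (flatten (map phi w)) = eval (eval f \o phi) w.
Proof.
by elim: w => [|j w IHw] /=; rewrite ?eval_nil // eval_cat eval_cons IHw.
Qed.

Lemma eval_filter1 I (c : I -> M) w :
  eval c [seq i <- w | c i != 1] = eval c w.
Proof.
elim: w => //= i w IHw; case: eqP => [ci|_] /=;
  rewrite ?[in RHS]eval_cons ?eval_cons IHw //.
by rewrite ci mul1g.
Qed.

End Eval.

(** * Green relations relative to a submonoid *)

Section Green.

Variables (M : monoidType) (P : M -> Prop).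
Hypotheses (P1 : P 1) (PM : forall s t, P s -> P t -> P (s * t)).

Lemma eval_in I (f : I -> M) w : (forall i, P (f i)) -> P (eval f w).
Proof.
by move=> Pf; elim: w => [|i w IHw]; rewrite ?eval_nil // eval_cons; apply: PM.
Qed.

Definition relR u v := (exists2 t, P t & u = v * t) /\ (exists2 t, P t & v = u * t).
Definition relL u v := (exists2 t, P t & u = t * v) /\ (exists2 t, P t & v = t * u).
Definition relH u v := relR u v /\ relL u v.

Lemma relR_refl u : relR u u.
Proof. by split; exists 1; rewrite ?mulg1. Qed.

Lemma relL_refl u : relL u u.
Proof. by split; exists 1; rewrite ?mul1g. Qed.

Lemma relR_sym u v : relR u v -> relR v u.
Proof. by case. Qed.

Lemma relL_sym u v : relL u v -> relL v u.
Proof. by case. Qed.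

Lemma relR_trans v u w : relR u v -> relR v w -> relR u w.
Proof.
move=> [[s Ps uE] [s' Ps' vE]] [[t Pt vE'] [t' Pt' wE]]; split.
  by exists (t * s); [apply: PM | rewrite mulgA -vE'].
by exists (s' * t'); [apply: PM | rewrite mulgA -vE].
Qed.

Lemma relL_trans v u w : relL u v -> relL v w -> relL u w.
Proof.
move=> [[s Ps uE] [s' Ps' vE]] [[t Pt vE'] [t' Pt' wE]]; split.
  by exists (s * t); [apply: PM | rewrite -mulgA -vE'].
by exists (t' * s'); [apply: PM | rewrite -mulgA -vE].
Qed.

Lemma relR_mull x u v : relR u v -> relR (x * u) (x * v).
Proof.
move=> [[s Ps uE] [t Pt vE]].
by split; [exists s | exists t] => //; rewrite -mulgA -?uE -?vE.
Qed.

Lemma relL_mulr x u v : relL u v -> relL (u * x) (v * x).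
Proof.
move=> [[s Ps uE] [t Pt vE]].
by split; [exists s | exists t] => //; rewrite mulgA -?uE -?vE.
Qed.

Lemma relR_in u v : relR u v -> P v -> P u.
Proof. by move=> [[s Ps ->] _] Pv; apply: PM. Qed.

Lemma relH_refl u : relH u u.
Proof. by split; [apply: relR_refl | apply: relL_refl]. Qed.

Lemma relH_sym u v : relH u v -> relH v u.
Proof. by move=> [/relR_sym uRv /relL_sym uLv]. Qed.

Lemma relH_trans v u w : relH u v -> relH v w -> relH u w.
Proof.
move=> [ur ul] [vr vl].
by split; [apply: relR_trans vr | apply: relL_trans vl].
Qed.

(** Right translation by a given element is the same on all of an L-class as on one
of its points, since the points are left multiples of each other. *)
Lemma relL_act u v s t : relL u v -> v * s = v * t -> u * s = u * t.
Proof. by move=> [[x _ ->] _] st; rewrite -!mulgA st. Qed.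

Lemma relL_fixed u v t : relL u v -> v * t = v -> u * t = u.
Proof.
by move=> uv vt; rewrite (relL_act (t := 1) uv) ?mulg1.
Qed.

(** A path under right translations that ends in the R-class it started from has
never left it. *)
Lemma relR_prefix u s t : P s -> P t -> relR (u * s * t) u -> relR (u * s) u.
Proof.
move=> Ps Pt [_ [x Px uE]]; split; first by exists s.
by exists (t * x); [apply: PM | rewrite mulgA].
Qed.

Lemma relR_fixed u s t : P s -> P t -> u * s * t = u -> relR (u * s) u.
Proof. by move=> Ps Pt uE; split; [exists s | exists t]. Qed.

(** The right action of [t] on the H-class of [u] preserves it, expressed on the
single point [u]; see [stabilizes_class]. *)
Definition stabilizes u t := P t /\ relH u (u * t).

(** If [u * t * t' = u] then [t * t'] fixes all left multiples of [u], hence the whole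
class, and likewise [t' * t]: the two act on the class as inverse bijections. *)
Lemma stabilizes_class u v t : stabilizes u t -> relH u v ->
  relH u (v * t) /\ exists2 w, relH u w & w * t = v.
Proof.
move=> [Pt uHt] uHv.
have [[[t' Pt' utt] _] _] := uHt.
have move_in x y s s' :
    P s -> P s' -> relH u x -> relH u y -> x * s = y -> y * s' = x ->
  forall z, relH u z -> relH u (z * s).
  move=> Ps Ps' ux uy xs ys z uz; have [zRx zLx] := relH_trans (relH_sym uz) ux.
  split.
    apply: relR_trans (uz.1) _; apply: relR_sym; apply: relR_fixed Ps Ps' _.
    by rewrite -mulgA (relL_fixed zLx) // mulgA xs ys.
  by apply: relL_trans (uy.2) _; rewrite -xs; apply/relL_mulr/relL_sym.
have uHu := relH_refl u.
split; first exact: move_in Pt Pt' uHu uHt erefl (esym utt) _ uHv.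
exists (v * t'); first exact: move_in Pt' Pt uHt uHu (esym utt) erefl _ uHv.
rewrite -mulgA (relL_fixed (relL_trans (relL_sym uHv.2) uHt.2)) //.
by rewrite mulgA -utt.
Qed.

(** * Representatives of the outer classes *)

Section Transversal.

Variables (Q : finType) (h : Q -> M) (cls : M -> Q) (q1 : Q).

(** The state [q1] stands for the whole submonoid, with representative 1: then every
element is both a left and a right multiple of its representative by an element
of the submonoid, whether it lies inside the submonoid or outside
([green_left], [green_right]), and the rewriting passes need no case distinction. *)
Record green_transversal : Prop := {
  green_h1 : h q1 = 1;
  green_in : forall u, cls u = q1 <-> P u;
  green_out : forall u, ~ P u -> relH u (h (cls u));
  green_hK : forall q, cls (h q) = q;
  green_eq : forall u v, ~ P u -> relH u v -> cls u = cls v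
}.

Hypothesis hcls : green_transversal.

Lemma green_h_out q : q <> q1 <-> ~ P (h q).
Proof. by rewrite -(green_in hcls) (green_hK hcls). Qed.

Lemma green_left u : exists2 t, P t & u = t * h (cls u).
Proof.
have [Pu|/(green_out hcls)[_ [[t Pt uE] _]]] := pselect (P u); last by exists t.
by exists u; rewrite // ((green_in hcls u).2 Pu) (green_h1 hcls) mulg1.
Qed.

Lemma green_right u : exists2 t, P t & u = h (cls u) * t.
Proof.
have [Pu|/(green_out hcls)[[[t Pt uE] _] _]] := pselect (P u); last by exists t.
by exists u; rewrite // ((green_in hcls u).2 Pu) (green_h1 hcls) mul1g.
Qed.

(** Letters are moved one by one across a representative, by [green_left]; the
representative reached is that of the last letter times a representative, not
that of the whole product, so a second pass is needed to locate the product. *)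
Lemma left_pass I J (a : I -> M) (b : J -> M) (bw : Q -> I -> seq J) w :
  (forall q i, h q * a i = eval b (bw q i) * h (cls (h q * a i))) ->
  let s := transduce (fun q i => cls (h q * a i)) (fun q i => rev (bw q i)) q1 [::] w in
  eval a w = eval b (rev s.2) * h s.1.
Proof.
move=> bwE; elim/last_ind: w => [|w i /= IHw].
  by rewrite /= !eval_nil (green_h1 hcls) mulg1.
rewrite transduce_rcons eval_rcons {}IHw /=.
by rewrite rev_cat revK eval_cat -!mulgA; congr (_ * _); apply: bwE.
Qed.

Definition in_class x q := if q == q1 then P x else relR x (h q).

(** R is a left congruence, which is why the second pass reads from right to left. *)
Lemma in_class_step t x q : P t -> in_class x q -> in_class (t * x) (cls (t * h q)).
Proof.
rewrite /in_class => Pt; case: (q =P q1) => [->|q_out] xq.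
  have ht : cls (t * h q1) = q1 by apply/green_in; rewrite ?(green_h1 hcls) ?mulg1.
  by rewrite ht eqxx; apply: PM.
have tR := relR_mull t xq; case: (_ =P q1) => [/(green_in hcls)|out].
  exact: relR_in.
by apply: relR_trans tR _; apply: (green_out hcls _).1 => /(green_in hcls).
Qed.

(** Starting from the representative at the right end, factors are moved across it by
[green_right]; the state reached tells whether the product lies in the submonoid
and, if not, in which R-class. *)
Lemma right_pass I J (b : I -> M) (c : J -> M) (cw : Q -> I -> seq J) q w :
  (forall i, P (b i)) ->
  (forall q i, b i * h q = h (cls (b i * h q)) * eval c (cw q i)) ->
  let s := transduce (fun q i => cls (b i * h q)) cw q [::] w in
  eval b (rev w) * h q = h s.1 * eval c s.2 /\
  in_class (eval b (rev w) * h q) s.1.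
Proof.
move=> Pb cwE; elim/last_ind: w => [|w i [/= IHe IHc]].
  rewrite /= !eval_nil mul1g mulg1; split=> //; rewrite /in_class.
  by case: eqP => [->|_]; [rewrite (green_h1 hcls) | apply: relR_refl].
rewrite transduce_rcons rev_rcons eval_cons -mulgA; split=> /=.
  by rewrite IHe mulgA [in LHS]cwE -mulgA -eval_cat.
exact: in_class_step.
Qed.

(** * Schreier rewriting inside an R-class *)

Section Schreier.

Variables (i : Q) (p p' : Q -> M).
Hypotheses (i_out : ~ P (h i))
  (Pp : forall k, P (p k)) (Pp' : forall k, P (p' k))
  (pK : forall k, relR (h i) (h k) -> h i * p k = h k)
  (p'K : forall k, relR (h i) (h k) -> h k * p' k = h i).

Lemma out_of_R u : relR (h i) u -> ~ P u.
Proof. by move=> uR Pu; apply: i_out; apply: relR_in uR Pu. Qed.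

(** [p' k] carries the class of [h k] to that of [h i] and [p k] carries it back. *)
Lemma class_back x : relR (h i) x -> x * p' (cls x) * p (cls x) = x.
Proof.
move=> ix; have [xkR xkL] := green_out hcls (out_of_R ix).
have ik := relR_trans ix xkR.
by rewrite -mulgA (relL_fixed xkL) // mulgA p'K // pK.
Qed.

(** The loop at [h i] that goes to the class of [h k], follows [t], and returns. *)
Definition schreier k t := p k * t * p' (cls (h k * t)).

Lemma schreier_stabilizes k t : P t ->
  relR (h i) (h k) -> relR (h k) (h k * t) -> stabilizes (h i) (schreier k t).
Proof.
move=> Pt ik kt; split; first by apply: (PM (PM _ _)).
have it := relR_trans ik kt; have [tR tL] := green_out hcls (out_of_R it).
rewrite /schreier !mulgA pK //; set k' := cls _ in tR tL *.
have ik' := relR_trans it tR.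
split; last by rewrite -(p'K ik'); apply/relL_mulr/relL_sym.
have back := relR_fixed (Pp' k') (Pp k') (class_back it).
exact: relR_trans it (relR_sym back).
Qed.

(** A path inside an R-class is, up to the final return to the class of [h i], a
product of Schreier loops at [h i]. The state is the H-class of the point reached,
which [b c] sends to the class of [h k * b c], L being a right congruence. *)
Lemma schreier_pass J L (b : J -> M) (g : L -> M) (gw : Q -> J -> seq L) j w :
  (forall c, P (b c)) ->
  (forall k c, relR (h i) (h k) -> relR (h k) (h k * b c) ->
     h i * schreier k (b c) = h i * eval g (gw k c)) ->
  relR (h i) (h j) -> relR (h j * eval b w) (h j) ->
  let s := transduce (fun k c => cls (h k * b c)) (fun k c => rev (gw k c)) j [::] w in
  s.1 = cls (h j * eval b w) /\ h j * eval b w * p' s.1 = h i * eval g (rev s.2).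
Proof.
move=> Pb gwE ij; elim/last_ind: w => [|w c IHw].
  by rewrite /= !eval_nil !mulg1 (green_hK hcls) p'K.
rewrite eval_rcons mulgA => xcR.
have xR : relR (h j * eval b w) (h j) by apply: relR_prefix xcR => //; apply: eval_in.
have [/= sE xE] := IHw xR; rewrite transduce_rcons /=.
move: (transduce _ _ _ _ w) => s in sE xE *; rewrite {}sE in xE *.
set x := h j * eval b w in xR xcR xE *.
have ix : relR (h i) x := relR_trans ij (relR_sym xR).
have [xkR xkL] := green_out hcls (out_of_R ix); set k := cls x in xE xkR xkL *.
have ik := relR_trans ix xkR.
have kcR : relR (h k) (h k * b c).
  have [_ [t Pt xt]] := relR_trans xcR (relR_sym xR).
  split; last by exists (b c).
  exists t; rewrite // -mulgA; apply/esym; apply: relL_fixed (relL_sym xkL) _.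
  by rewrite mulgA.
have xkc : relH (x * b c) (h k * b c).
  split; last exact: relL_mulr.
  apply: relR_trans (relR_trans xcR _) kcR.
  exact: relR_trans (relR_sym xR) xkR.
have ixc := relR_trans ij (relR_sym xcR).
have clsE := green_eq hcls (out_of_R ixc) xkc.
split; first by rewrite clsE.
rewrite rev_cat revK eval_cat mulgA -xE.
rewrite -[in LHS](class_back ix) -/k.
have xiL : relL (x * p' k) (h i) by rewrite -(p'K ik); apply: relL_mulr.
by have := relL_act xiL (gwE k c ik kcR); rewrite /schreier !mulgA.
Qed.

End Schreier.

Lemma class_translations i : exists p p' : Q -> M, [/\ forall k, P (p k),
  forall k, P (p' k), forall k, relR (h i) (h k) -> h i * p k = h k &
  forall k, relR (h i) (h k) -> h k * p' k = h i].
Proof.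
have /choice[pp ppP] : forall k, exists t : M * M, [/\ P t.1, P t.2,
    relR (h i) (h k) -> h i * t.1 = h k & relR (h i) (h k) -> h k * t.2 = h i].
  move=> k; have [[[t' Pt' iE] [t Pt kE]]|out] := pselect (relR (h i) (h k)).
    by exists (t, t'); split.
  by exists (1, 1); split.
by exists (fun k => (pp k).1), (fun k => (pp k).2); split=> k; case: (ppP k).
Qed.

Lemma schreier_word i p p' J (b : J -> M) L (g : L -> M) :
  i <> q1 -> (forall k, P (p k)) -> (forall k, P (p' k)) ->
  (forall k, relR (h i) (h k) -> h i * p k = h k) ->
  (forall k, relR (h i) (h k) -> h k * p' k = h i) ->
  (forall c, P (b c)) ->
  (forall t, stabilizes (h i) t -> exists w, h i * t = h i * eval g w) ->
  exists gw : Q -> J -> seq L,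
  forall k c, relR (h i) (h k) -> relR (h k) (h k * b c) ->
    h i * schreier p p' k (b c) = h i * eval g (gw k c).
Proof.
move=> /green_h_out i_out Pp Pp' pK p'K Pb gP.
have /choice[gw gwE] : forall kc : Q * J, exists w,
    relR (h i) (h kc.1) -> relR (h kc.1) (h kc.1 * b kc.2) ->
    h i * schreier p p' kc.1 (b kc.2) = h i * eval g w.
  case=> k c /=; have [ik|] := pselect (relR (h i) (h k)); last by exists [::].
  have [kc|] := pselect (relR (h k) (h k * b c)); last by exists [::].
  have [w wE] := gP _ (schreier_stabilizes i_out Pp Pp' pK p'K (Pb c) ik kc).
  by exists w.
by exists (fun k c => gw (k, c)) => k c; apply: gwE (k, c).
Qed.

(** * Comparing two words *)

Section Decision.

Variables (m : nat) (b : 'I_m -> M).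
Hypothesis Pb : forall c, P (b c).

(** After the Schreier pass two elements of one R-class are equal exactly when they
lie in the same H-class and their loops at [h i] move [h i] in the same way. *)
Lemma decides_R_class i j j' l (g : 'I_l -> M) : i <> q1 ->
  (forall t, stabilizes (h i) t -> exists w, h i * t = h i * eval g w) ->
  decides_all (fun u v => h i * eval g u == h i * eval g v) ->
  relR (h i) (h j) -> relR (h i) (h j') ->
  decides (fun x => relR (h j * eval b x) (h j))
    (fun y => relR (h j' * eval b y) (h j'))
    (fun x y => h j * eval b x == h j' * eval b y).
Proof.
move=> iq gP decg ij ij'; have i_out := (green_h_out i).1 iq.
have [p [p' [Pp Pp' pK p'K]]] := class_translations i.
have [gw gwE] := schreier_word iq Pp Pp' pK p'K Pb gP.
pose next k c := cls (h k * b c).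
pose emit k c := rev (gw k c).
apply: (decides_transduce (next := next) (emit := emit) (q0 := j) (o0 := [::])
  (next' := next) (emit' := emit) (q0' := j') (o0' := [::])
  (X := fun _ _ => True) (X' := fun _ _ => True)
  (Y := fun k k' x y => (k == k') && (h i * eval g (rev x) == h i * eval g (rev y))))
  => // [k k'|x y xR yR].
  case: (k == k'); last exact: (decides_const (b := false)).
  exact: decides_rev decg.
have ix := relR_trans ij (relR_sym xR); have iy := relR_trans ij' (relR_sym yR).
have [xk xE] := schreier_pass i_out pK p'K Pb gwE ij xR.
have [yk yE] := schreier_pass i_out pK p'K Pb gwE ij' yR.
rewrite -/next -/emit in xk xE yk yE; rewrite -xE -yE xk yk.
apply/eqP/andP => [->|[/eqP kE /eqP xyE]]; first by rewrite !eqxx.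
rewrite -(class_back i_out pK p'K ix) -(class_back i_out pK p'K iy).
by rewrite xyE kE.
Qed.

Hypothesis b_gen : forall t, P t -> exists w, t = eval b w.
Hypothesis decb : decides_all (fun u v => eval b u == eval b v).
Hypothesis decg : forall i, i <> q1 -> exists l (g : 'I_l -> M),
  (forall t, stabilizes (h i) t -> exists w, h i * t = h i * eval g w) /\
  decides_all (fun u v => h i * eval g u == h i * eval g v).

(** An element knows its R-class and whether it lies in the submonoid, so different
answers settle the comparison and equal answers reduce it to the word problem of
the submonoid or to [decides_R_class]. *)
Lemma decides_in_class k k' :
  decides (fun x => in_class (h k * eval b x) k)
    (fun y => in_class (h k' * eval b y) k')
    (fun x y => h k * eval b x == h k' * eval b y).
Proof.
rewrite /in_class; case: (k =P q1) => [->|kq]; case: (k' =P q1) => [->|k'q].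
- by apply: decides_ext decb _ _ _ => // x y; rewrite (green_h1 hcls) !mul1g.
- apply: (decides_const (b := false)) => x y Px yR; apply/eqP => xy.
  by apply: (green_h_out k').1 k'q _; apply: relR_in (relR_sym yR) _; rewrite -xy.
- apply: (decides_const (b := false)) => x y xR Py; apply/eqP => xy.
  by apply: (green_h_out k).1 kq _; apply: relR_in (relR_sym xR) _; rewrite xy.
have [kk'|kk'] := pselect (relR (h k) (h k')).
  have [l [g [gP gdec]]] := decg kq.
  exact: decides_R_class kq gP gdec (relR_refl _) kk'.
apply: (decides_const (b := false)) => x y xR yR; apply/eqP => xy; apply: kk'.
by apply: relR_trans (relR_sym xR) _; rewrite xy.
Qed.

Lemma decides_left_multiples q q' :
  decides_all (fun x y => eval b (rev x) * h q == eval b (rev y) * h q').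
Proof.
have /choice[cw cwE] : forall qi : Q * 'I_m, exists w,
    b qi.2 * h qi.1 = h (cls (b qi.2 * h qi.1)) * eval b w.
  case=> k i; have [t /b_gen[w ->] tE] := green_right (b i * h k).
  by exists w.
pose next k i := cls (b i * h k).
pose emit k i := cw (k, i).
have passE k w := right_pass k w Pb (fun k i => cwE (k, i)).
apply: (decides_transduce (next := next) (emit := emit) (q0 := q) (o0 := [::])
  (next' := next) (emit' := emit) (q0' := q') (o0' := [::])
  decides_in_class) => [x _|y _|x y _ _].
- by have [<-] := passE q x.
- by have [<-] := passE q' y.
by have [<- _] := passE q x; have [<- _] := passE q' y.
Qed.

Theorem decides_green n (a : 'I_n -> M) :
  decides_all (fun u v => eval a u == eval a v).
Proof.
have /choice[bw bwE] : forall qi : Q * 'I_n, exists w,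
    h qi.1 * a qi.2 = eval b w * h (cls (h qi.1 * a qi.2)).
  case=> k i; have [t /b_gen[w ->] tE] := green_left (h k * a i).
  by exists w.
pose next k i := cls (h k * a i).
pose emit k i := rev (bw (k, i)).
have passE w := left_pass w (a := a) (bw := fun k i => bw (k, i)) (fun k i => bwE (k, i)).
apply: (decides_transduce (next := next) (emit := emit) (q0 := q1) (o0 := [::])
  (next' := next) (emit' := emit) (q0' := q1) (o0' := [::])
  decides_left_multiples) => // u v _ _.
by rewrite !passE.
Qed.

End Decision.

(** If the product lies in the submonoid, the second pass must end in the state of the
submonoid, and then the elements it emitted multiply to the given one. There are
only finitely many of them: one for each state of the second pass and each state
and letter of the first. *)
Lemma submonoid_generators (I : Type) (a : I -> M) :
  (forall u, exists w, u = eval a w) ->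
  exists2 c : Q * (Q * I) -> M, (forall j, P (c j)) &
    forall t, P t -> exists w, t = eval c w.
Proof.
move=> a_gen.
have /choice[s sP] : forall qi : Q * I, exists t, P t /\
    h qi.1 * a qi.2 = t * h (cls (h qi.1 * a qi.2)).
  by case=> q i; have [t Pt tE] := green_left (h q * a i); exists t.
have /choice[c cP] : forall qj : Q * (Q * I), exists t, P t /\
    s qj.2 * h qj.1 = h (cls (s qj.2 * h qj.1)) * t.
  by case=> q j; have [t Pt tE] := green_right (s j * h q); exists t.
exists c => [j|t Pt]; first by case: (cP j).
have [w tE] := a_gen t.
have sE q i : h q * a i = eval s [:: (q, i)] * h (cls (h q * a i)).
  by rewrite eval_seq1; case: (sP (q, i)).
have cE q j : s j * h q = h (cls (s j * h q)) * eval c [:: (q, j)].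
  by rewrite eval_seq1; case: (cP (q, j)).
have := left_pass w (a := a) (bw := fun q i => [:: (q, i)]) sE.
set x := transduce _ _ _ _ _ => /= xE.
have [] := right_pass (cw := fun q j => [:: (q, j)]) x.1 x.2 (fun j => (sP j).1) cE.
rewrite -xE -tE; move: (transduce _ _ _ _ _) => y yE yC.
exists y.2; rewrite yE; suff -> : y.1 = q1 by rewrite (green_h1 hcls) mul1g.
apply: contrapT => yq; move: yC; rewrite /in_class; case: eqP => // _ tR.
by apply: (green_h_out y.1).1 yq _; apply: relR_in (relR_sym tR) Pt.
Qed.

(** Schreier generators. A path that leaves the R-class yields no loop; it is replaced
by 1, so that every listed element stabilizes the class. *)
Lemma schutzenberger_generators (i : Q) J (b : J -> M) : i <> q1 ->
  (forall c, P (b c)) -> (forall t, P t -> exists w, t = eval b w) ->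
  exists2 g : Q * J -> M, (forall j, stabilizes (h i) (g j)) &
    forall t, stabilizes (h i) t -> exists w, h i * t = h i * eval g w.
Proof.
move=> iq Pb b_gen; have i_out := (green_h_out i).1 iq.
have [p [p' [Pp Pp' pK p'K]]] := class_translations i.
pose s kc := schreier p p' kc.1 (b kc.2).
have stab1 : stabilizes (h i) 1 by split=> //; rewrite mulg1; apply: relH_refl.
pose g kc := if pselect (stabilizes (h i) (s kc)) then s kc else 1.
exists g => [kc|t [Pt iHt]]; first by rewrite /g; case: pselect.
have gE k c : relR (h i) (h k) -> relR (h k) (h k * b c) ->
    h i * schreier p p' k (b c) = h i * eval g [:: (k, c)].
  move=> ik kc; rewrite eval_seq1 /g; case: pselect => // -[].
  exact: schreier_stabilizes.
have [w tE] := b_gen t Pt; rewrite tE in iHt *.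
have [/=] := schreier_pass i_out pK p'K Pb gE (relR_refl _) (relR_sym iHt.1).
move: (transduce _ _ _ _ _) => x -> xE; exists (rev x.2); rewrite -xE.
have := green_eq hcls (out_of_R i_out iHt.1) (relH_sym iHt).
rewrite (green_hK hcls) => ->; apply/esym.
by rewrite (relL_fixed (relL_sym iHt.2)) // p'K //; apply: relR_refl.
Qed.

End Transversal.
End Green.

Local Open Scope classical_set_scope.
Local Open Scope quotient_scope.

(** * The monoid obtained from a semigroup by adjoining an identity *)

Section Bridge.

Variables (S : semigroupType) (T : mulgClosed S).
Implicit Types H : set S.

Local Notation P := (sub1 T).

Let P1 : P 1. Proof. by left. Qed.

Let PM (s t : adjoin1 S) : P s -> P t -> P (s * t). Proof. exact: sub1M. Qed.

Lemma sub1_to1 v : P (to1 v) <-> v \in T.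
Proof.
split=> [[//|[t tT [<-]]] // | vT]; by right; exists v.
Qed.

Lemma greenR_relR u v : greenR T u v <-> relR P (to1 u) (to1 v).
Proof.
split=> [uv|[[s Ps uE] [t Pt vE]]].
  have uu : [set to1 u * t | t in P] (to1 u) by exists 1; rewrite ?mulg1.
  have vv : [set to1 v * t | t in P] (to1 v) by exists 1; rewrite ?mulg1.
  by rewrite uv in uu; rewrite -uv in vv; case: uu vv => s Ps <- [t Pt tE];
    split; [exists s | exists t].
apply/seteqP; split=> _ [x Px <-].
  by exists (s * x); rewrite ?mulgA -?uE //; apply: PM.
by exists (t * x); rewrite ?mulgA -?vE //; apply: PM.
Qed.

Lemma greenL_relL u v : greenL T u v <-> relL P (to1 u) (to1 v).
Proof.
split=> [uv|[[s Ps uE] [t Pt vE]]].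
  have uu : [set t * to1 u | t in P] (to1 u) by exists 1; rewrite ?mul1g.
  have vv : [set t * to1 v | t in P] (to1 v) by exists 1; rewrite ?mul1g.
  by rewrite uv in uu; rewrite -uv in vv; case: uu vv => s Ps <- [t Pt tE];
    split; [exists s | exists t].
apply/seteqP; split=> _ [x Px <-].
  by exists (x * s); rewrite -?mulgA -?uE //; apply: PM.
by exists (x * t); rewrite -?mulgA -?vE //; apply: PM.
Qed.

Lemma greenH_relH u v : greenH T u v <-> relH P (to1 u) (to1 v).
Proof. by rewrite /greenH greenR_relR greenL_relL. Qed.

Lemma outer_class u : ~ P (to1 u) <-> outer_greenH_class T [set v | greenH T u v].
Proof.
split=> [u_out|[_ uT] Pu].
  split; first by exists u.
  move=> v /= /greenH_relH[uv _] vT; apply: u_out; apply: relR_in uv _ => //.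
  exact/sub1_to1.
by apply: (uT u); [apply/greenH_relH/relH_refl | apply/sub1_to1].
Qed.

Lemma outer_classP H : outer_greenH_class T H ->
  exists2 u, ~ P (to1 u) & H = [set v | greenH T u v].
Proof.
move=> HT; have [[u HE] _] := HT.
by exists u => //; apply/outer_class; rewrite -HE.
Qed.

(** The outer classes themselves serve as states, so that H-related elements have
equal states; [None] is the state of the submonoid. *)
Lemma finite_green_transversal : finite_green_index T ->
  exists (Q : finType) (h : Q -> adjoin1 S) cls q1, green_transversal P h cls q1 /\
    forall H, outer_greenH_class T H -> exists i u, [/\ i <> q1, h i = to1 u &
      H = [set v | greenH T u v]].
Proof.
move=> /finite_seqP[s sE].
have inS H : outer_greenH_class T H <-> H \in s by rewrite sE.
have /choice[r rP] : forall x : seq_sub s, exists u,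
    ~ P (to1 u) /\ ssval x = [set v | greenH T u v].
  by move=> x; have /inS/outer_classP[u] := ssvalP x; exists u.
pose h (q : option (seq_sub s)) : adjoin1 S := if q is Some x then to1 (r x) else None.
pose cls (u : adjoin1 S) : option (seq_sub s) :=
  if pselect (P u) then None
  else if u is Some v then insub [set w | greenH T v w] else None.
have clsN (u : adjoin1 S) : P u -> cls u = None by rewrite /cls; case: pselect.
have clsS v : ~ P (to1 v) ->
    exists2 x, cls (to1 v) = Some x & ssval x = [set w | greenH T v w].
  move=> v_out; rewrite /cls; case: pselect => //= _.
  case: insubP => [x _ <-|]; first by exists x.
  by have /inS -> := (outer_class v).1 v_out.
have out1 (u : adjoin1 S) : ~ P u -> exists v, u = to1 v.
  by case: u => [v|] // _; exists v.
have clsE v x : ~ P (to1 v) -> ssval x = [set w | greenH T v w] -> cls (to1 v) = Some x.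
  by move=> /clsS[y -> yE] xE; congr Some; apply: val_inj; rewrite /= xE.
have classE u v : relH P (to1 u) (to1 v) ->
    [set w | greenH T u w] = [set w | greenH T v w].
  move=> uv; apply/seteqP; split=> w /= /greenH_relH wH; apply/greenH_relH.
    exact: relH_trans (relH_sym uv) wH.
  exact: relH_trans uv wH.
exists (option (seq_sub s)), h, cls, None; split.
  split=> //.
  - move=> u; split=> [|/clsN //]; have [//|/[dup] u_out /out1[v uE]] := pselect (P u).
    by rewrite uE in u_out *; have [x ->] := clsS v u_out.
  - move=> u /[dup] u_out /out1[v uE]; rewrite uE in u_out *.
    have [x -> xE] := clsS v u_out; have [_ /= xE'] := rP x.
    apply/greenH_relH; have : [set w | greenH T v w] (r x).
      by rewrite -xE xE' /=; apply/greenH_relH/relH_refl.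
    by [].
  - by case=> [x|] /=; [have [] := rP x; apply: clsE | apply: clsN].
  - move=> u v u_out uv; have v_out : ~ P v.
      by move=> Pv; apply: u_out; apply: relR_in uv.1 Pv.
    have [u' uE] := out1 u u_out; have [v' vE] := out1 v v_out.
    rewrite uE vE in u_out v_out uv *.
    by have [x -> xE] := clsS _ u_out; rewrite (clsE _ x) // xE; apply: classE.
move=> H /inS Hs; have [] := rP (SeqSub Hs); set i := SeqSub Hs => _ HE.
by exists (Some i), (r i).
Qed.

Section WordsInT.

Variables (n : nat) (b : 'I_n -> subsemigroup T).

Lemma word_val_subsemigroup w :
  omap val (word_val b w) = eval (fun i => to1 (val (b i))) w.
Proof.
elim: w => [|i w IHw]; first by rewrite eval_nil /word_val big_nil.
rewrite eval_cons -IHw /word_val big_cons.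
by case: (\prod_(_ <- _) _).
Qed.

Lemma word_val_subsemigroup_eq u v :
  (word_val b u == word_val b v) =
  (eval (fun i => to1 (val (b i))) u == eval (fun i => to1 (val (b i))) v).
Proof.
rewrite -!word_val_subsemigroup; apply/eqP/eqP => [-> //|].
by case: (word_val b u) (word_val b v) => [x|] [y|] //= [/val_inj ->].
Qed.

End WordsInT.

End Bridge.

(** * Word problems on all words, empty ones included *)

Lemma word_val_eval (S : semigroupType) n (a : 'I_n -> S) w :
  word_val a w = eval (fun i => to1 (a i)) w.
Proof. by []. Qed.

Lemma word_val_nonempty (S : semigroupType) n (a : 'I_n -> S) w :
  w <> [::] -> exists x, word_val a w = to1 x.
Proof.
case: w => // i w _; rewrite word_val_eval eval_cons.
by case: (eval _ w) => [x|]; [exists (a i * x) | exists (a i)].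
Qed.

(** The definition says nothing about the empty word, but in the monoid with an
adjoined identity the empty word differs from all others. *)
Lemma word_problem_decidableP (S : semigroupType) n (a : 'I_n -> S) :
  word_problem_decidable a <->
  decides_all (fun u v => word_val a u == word_val a v).
Proof.
split=> [[f rf fE]|[f rf fE]]; last by exists f => // u v _ _; rewrite fE.
exists (fun x => if tnth x ord0 == 0%N then if tnth x ord_max == 0%N then 1%N else 0%N
         else if tnth x ord_max == 0%N then 0%N else f x).
  by do ![apply: recursive_if] => //; try exact: recursive_const; apply: recursive_tnth.
have code0 (w : seq 'I_n) : (word_code w == 0%N) = (w == [::]).
  by case: w => //= i w; apply/negbTE; rewrite -lt0n; apply: code_cons_gt0.
have val0 w : w <> [::] -> (word_val a w == 1) = false /\ (1 == word_val a w) = false.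
  by move=> /(word_val_nonempty a)[x ->].
have nil0 : word_val a [::] = 1 by rewrite word_val_eval eval_nil.
move=> u v _ _; rewrite !(tnth_nth 0%N) /= !code0.
case: (u =P [::]) => [->|u0]; case: (v =P [::]) => [->|v0].
- by rewrite eqxx.
- by rewrite nil0 (val0 v v0).2.
- by rewrite nil0 (val0 u u0).1.
- exact: fE.
Qed.

(** * Words in a relative Schutzenberger group *)

Section SchutzenbergerWords.

Variables (S : semigroupType) (T : mulgClosed S) (r : S).
Local Notation P := (sub1 T).
Local Notation H := [set v | greenH T r v].
Hypothesis r_out : ~ P (to1 r).

Let P1 : P 1. Proof. by left. Qed.

Let PM (s t : adjoin1 S) : P s -> P t -> P (s * t). Proof. exact: sub1M. Qed.

Lemma stab_stabilizes t : t \in stab T H <-> stabilizes P (to1 r) t.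
Proof.
have rH : H r by apply/greenH_relH/relH_refl.
split=> [/set_mem[Pt HtH]|rt].
  split=> //; have [v /greenH_relH vH <-] // : [set to1 h | h in H] (to1 r * t).
  by rewrite -HtH; exists r.
have out1 (u : adjoin1 S) : relH P (to1 r) u -> exists2 v, H v & u = to1 v.
  case: u => [v|] ru; first by exists v => //; apply/greenH_relH.
  by case: r_out; apply: relR_in ru.1 P1.
apply/mem_set; split; first by case: rt.
apply/seteqP; split=> _ [v /greenH_relH vH <-].
  have [vt _] := stabilizes_class P1 PM rt vH.
  by have [w wH ->] := out1 _ vt; exists w.
have [_ [u /out1[w wH ->] <-]] := stabilizes_class P1 PM rt vH.
by exists w.
Qed.

(** Elements of the group are told apart by their action on the single point [r]. *)
Lemma schutz_piP (x y : stabilizer T H) :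
  (\pi_(schutzenberger T H) x = \pi_(schutzenberger T H) y) <->
  to1 r * val x = to1 r * val y.
Proof.
split=> [/eqmodP/asboolP|xy]; first by apply; apply/greenH_relH/relH_refl.
apply/eqmodP/asboolP=> v /greenH_relH[_ /relL_sym vr].
exact: relL_act vr xy.
Qed.

Variables (l : nat) (g : 'I_l -> schutzenberger T H) (y : 'I_l -> stabilizer T H).
Hypothesis gy : forall i, g i = \pi_(schutzenberger T H) (y i).

(** Only nonempty words: the empty one denotes the adjoined identity, which differs
from the identity of the group. *)
Lemma word_val_schutz w : w <> [::] ->
  exists2 x : stabilizer T H, word_val g w = to1 (\pi_(schutzenberger T H) x) &
    val x = eval (fun i => val (y i)) w.
Proof.
elim: w => // i [|j w] IHw _.
  exists (y i); last by rewrite eval_seq1.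
  by rewrite word_val_eval eval_seq1 gy.
have [//|x wE xE] := IHw; exists (y i * x).
  rewrite word_val_eval eval_cons -word_val_eval wE gy /=.
  congr to1; exact: schutz_mul_pi.
by rewrite valM xE [RHS]eval_cons.
Qed.

Lemma word_val_schutz_eq u v : u <> [::] -> v <> [::] ->
  (word_val g u == word_val g v) =
  (to1 r * eval (fun i => val (y i)) u == to1 r * eval (fun i => val (y i)) v).
Proof.
move=> /word_val_schutz[x -> <-] /word_val_schutz[z -> <-].
by apply/eqP/eqP => [[/schutz_piP] | /schutz_piP ->].
Qed.

End SchutzenbergerWords.

(** * Transfer of word problems *)

Section Main.

Variables (S : semigroupType) (T : mulgClosed S).
Local Notation P := (sub1 T).

Let P1 : P 1. Proof. by left. Qed.

Let PM (s t : adjoin1 S) : P s -> P t -> P (s * t). Proof. exact: sub1M. Qed.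

Lemma generates_eval (R : semigroupType) n (a : 'I_n -> R) : generates a ->
  forall x : adjoin1 R, exists w, x = eval (fun i => to1 (a i)) w.
Proof.
move=> a_gen [x|]; last by exists [::]; rewrite eval_nil.
by have [w _ wE] := a_gen x; exists w.
Qed.

(** Word problems pass to anything whose generators are words in [a]. *)
Lemma decides_pullback n (a : 'I_n -> S) m (c : 'I_m -> adjoin1 S) x :
  generates a -> word_problem_decidable a ->
  decides_all (fun u v => x * eval c u == x * eval c v).
Proof.
move=> a_gen /word_problem_decidableP a_dec.
have [p xE] := generates_eval a_gen x.
have /choice[phi phiE] : forall i, exists w, c i = eval (fun i => to1 (a i)) w.
  by move=> i; apply: generates_eval.
apply: decides_ext (decides_subst phi phi p p a_dec) _ _ _ => // u v _ _.
rewrite !word_val_eval !eval_cat !eval_flatten -!xE.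
have phi_eval w : eval (eval (fun i => to1 (a i)) \o phi) w = eval c w.
  by apply: eq_bigr => i _; rewrite /= phiE.
by rewrite !phi_eval.
Qed.

(** Generators that equal the adjoined identity do not come from the subsemigroup;
they are erased from words and replaced by an arbitrary element in the list of
generators. An empty subsemigroup has no such element, and no generators. *)
Lemma subsemigroup_generators (I : finType) (c : I -> adjoin1 S) :
  (forall i, P (c i)) -> (forall t, P t -> exists w, t = eval c w) ->
  exists n (b : 'I_n -> subsemigroup T), generates b.
Proof.
move=> Pc c_gen.
have [[t0]|T0] := pselect (inhabited (subsemigroup T)); last first.
  by exists 0%N, (fun i : 'I_0 => False_rect _ (notF (ltn_ord i))) => x; case: T0.
have /choice[b bE] : forall i, exists x : subsemigroup T, c i <> 1 -> c i = to1 (val x).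
  move=> i; have [->|[v vT <-]] := Pc i; first by exists t0.
  by exists (Subsemigroup vT).
exists #|I|, (fun k => b (enum_val k)) => x.
have [|w wE] := c_gen (to1 (val x)); first by apply/sub1_to1/valP.
pose w' := [seq enum_rank i | i <- [seq i <- w | c i != 1]].
have w'E : omap val (word_val (fun k => b (enum_val k)) w') = to1 (val x).
  rewrite word_val_subsemigroup wE -(eval_filter1 c w) /eval big_map.
  rewrite !big_filter; apply: eq_bigr => i /eqP ci.
  by rewrite enum_rankK bE.
exists w'; last first.
  by case: (word_val _ _) w'E => //= z [/val_inj ->].
by move=> w'0; rewrite w'0 word_val_eval eval_nil in w'E.
Qed.

Lemma soluble_subsemigroup (I : finType) (c : I -> adjoin1 S) n (a : 'I_n -> S) :
  (forall i, P (c i)) -> (forall t, P t -> exists w, t = eval c w) ->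
  generates a -> word_problem_decidable a -> soluble_word_problem (subsemigroup T).
Proof.
move=> Pc c_gen a_gen a_dec.
have [m [b b_gen]] := subsemigroup_generators Pc c_gen.
exists m, b; split=> //; apply/word_problem_decidableP.
apply: decides_ext (decides_pullback (fun i => to1 (val (b i))) 1 a_gen a_dec) _ _ _ => //.
by move=> u v _ _; rewrite !mul1g word_val_subsemigroup_eq.
Qed.

(** The identity joins the generators, so that it is the value of a nonempty word. *)
Lemma soluble_schutzenberger r (I : finType) (c : I -> adjoin1 S) n (a : 'I_n -> S) :
  ~ P (to1 r) -> (forall i, stabilizes P (to1 r) (c i)) ->
  (forall t, stabilizes P (to1 r) t -> exists w, to1 r * t = to1 r * eval c w) ->
  generates a -> word_problem_decidable a ->
  soluble_word_problem (schutzenberger T [set v | greenH T r v]).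
Proof.
move=> r_out cP c_gen a_gen a_dec; set H := [set v | _].
have stabP t : t \in stab T H <-> stabilizes P (to1 r) t := stab_stabilizes r_out t.
pose y (i : option I) : stabilizer T H :=
  if i is Some j then Stabilizer ((stabP _).2 (cP j)) else 1.
pose yk (k : 'I_#|{: option I}|) := y (enum_val k).
pose g k := \pi_(schutzenberger T H) (yk k).
exists #|{: option I}|, g; split.
  move=> x; have [w wE] := c_gen _ ((stabP _).1 (stabilizer_valP (repr x))).
  pose w' := enum_rank None :: [seq enum_rank (Some i) | i <- w].
  exists w' => //.
  have [//|z -> zE] := word_val_schutz (y := yk) (g := g) (fun=> erefl) (w := w').
  rewrite -[x]reprK; congr to1; apply/schutz_piP.
  rewrite zE eval_cons /yk enum_rankK /= mul1g [RHS]wE.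
  rewrite [in LHS]/eval big_map; congr (_ * _).
  by apply: eq_bigr => i _; rewrite enum_rankK.
have [f rf fE] := decides_pullback (fun k => val (yk k)) (to1 r) a_gen a_dec.
exists f => // u v u0 v0; rewrite fE //.
by rewrite (word_val_schutz_eq (y := yk) (g := g) (fun=> erefl) u0 v0).
Qed.

(** Prefixing a nonempty word for the identity of the group makes all words nonempty
without moving [r], so that the empty word is treated as the identity. *)
Lemma schutzenberger_decides r : ~ P (to1 r) ->
  soluble_word_problem (schutzenberger T [set v | greenH T r v]) ->
  exists l (c : 'I_l -> adjoin1 S),
    (forall t, stabilizes P (to1 r) t -> exists w, to1 r * t = to1 r * eval c w) /\
    decides_all (fun u v => to1 r * eval c u == to1 r * eval c v).
Proof.
move=> r_out; set H := [set v | _] => -[l [g [g_gen [f rf fE]]]].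
have gy i : g i = \pi_(schutzenberger T H) (repr (g i)) by rewrite reprK.
exists l, (fun i => val (repr (g i))); split.
  move=> t /(stab_stabilizes r_out) tH.
  have [w w0 wE] := g_gen (\pi_(schutzenberger T H) (Stabilizer tH)).
  have [x xE eval_w] := word_val_schutz gy w0.
  by exists w; rewrite -eval_w; move: wE; rewrite xE => -[/schutz_piP ->].
have [e e0 eE] := g_gen 1; have [x xE eval_e] := word_val_schutz gy e0.
have re : to1 r * eval (fun i => val (repr (g i))) e = to1 r.
  by rewrite -eval_e; move: eE; rewrite xE => -[/schutz_piP ->]; rewrite mulg1.
have g_dec : decides (fun u => u <> [::]) (fun v => v <> [::])
    (fun u v => word_val g u == word_val g v) by exists f.
have e_cat0 (w : seq 'I_l) : e ++ flatten [seq [:: i] | i <- w] <> [::] by case: (e) e0.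
apply: decides_ext (decides_subst (fun i => [:: i]) (fun i => [:: i]) e e g_dec) _ _ _ => //.
by move=> u v _ _; rewrite (word_val_schutz_eq gy) // !flatten_seq1 !eval_cat !mulgA re.
Qed.

End Main.

Theorem theorem8p1 (S : semigroupType) (T : mulgClosed S) :
  finitely_generated S ->
  finite_green_index T ->
  (soluble_word_problem S <->
     soluble_word_problem (subsemigroup T) /\
     forall H : set S, outer_greenH_class T H ->
       soluble_word_problem (schutzenberger T H)).
Proof.
move=> S_fg T_fin.
have P1 : sub1 T 1 by left.
have PM := @sub1M S T.
have [Q [h [cls [q1 [hcls hH]]]]] := finite_green_transversal T_fin.
split=> [[n [a [a_gen a_dec]]]|[[m [b [b_gen b_dec]]] G_sol]].
  have [c Pc c_gen] := submonoid_generators P1 PM hcls (generates_eval a_gen).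
  split; first exact: soluble_subsemigroup Pc c_gen a_gen a_dec.
  move=> _ /hH[i [r [iq hr ->]]].
  have [d dP d_gen] := schutzenberger_generators P1 PM hcls iq Pc c_gen.
  rewrite hr in dP d_gen; apply: soluble_schutzenberger dP d_gen a_gen a_dec.
  by rewrite -hr; apply/(green_h_out hcls).
have [n [a a_gen]] := S_fg; exists n, a; split=> //; apply/word_problem_decidableP.
pose c i := to1 (val (b i)).
have Pc i : sub1 T (c i) by apply/sub1_to1/valP.
apply: (decides_green P1 PM hcls Pc).
- move=> t [->|[v vT <-]]; first by exists [::]; rewrite eval_nil.
  have [w _ wE] := b_gen (Subsemigroup vT); exists w.
  by rewrite -word_val_subsemigroup wE.
- apply: decides_ext ((word_problem_decidableP b).1 b_dec) _ _ _ => // u v _ _.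
  exact: word_val_subsemigroup_eq.
move=> i /(green_h_out hcls); case: (h i) => [r|] r_out; last by case: r_out.
by apply: schutzenberger_decides => //; apply/G_sol/outer_class.
Qed.
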